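(* The Weil module $X$ of $U$ is multiplicity free.
   Context: Setting. $R$ is a finite commutative local principal ring of odd prime characteristic $p$, with maximal ideal $\mathfrak m$ of nilpotency degree $\ell\ge 1$ and residue field $R/\mathfrak m\cong F_q$. Let $x$ be a generator of $\mathfrak m$ and $A=R[t]/(t^2-x)=R\oplus Ry$, $y^2=x$ (ramified quadratic extension of $R$), with involution $(r+sy)^*=r-sy$ ($r,s\in R$). $A$ is a finite local principal ring with maximal ideal $\mathfrak r=Ay$ of nilpotency degree $2\ell$ and residue field $F_q$. Put $\mathfrak i=\mathfrak r^\ell=Ay^\ell$. $V$ is a free $A$-module of finite rank $m\ge 1$ and $h:V\times V\to A$ is a non-degenerate hermitian form: $h$ is bi-additive, $A$-linear in the second variable, $h(v,u)=h(u,v)^*$, and $v\mapsto h(v,-)$ is a bijection $V\to \mathrm{Hom}_A(V,A)$. $U=\{g\in \mathrm{GL}_A(V): h(gu,gv)=h(u,v)\ \forall u,v\in V\}$. Let $d:A\to R$, $d(r+sy)=2s$. Fix a primitive linear character $\lambda:R^+\to\mathbf C^\times$ (its kernel contains no non-zero ideal of $R$) and put $\mu=\lambda\circ d:A^+\to\mathbf C^\times$. Weil module. Let $T$ be a transversal for $\mathfrak iV$ in $V$. The Weil module $X$ (of type $\mu$) is the complex $U$-module with basis $\{e_v: v\in T\}$ and action $ge_v=\mu(h(gv,v'))e_{v'}$ for $g\in U$, $v,v'\in T$, $gv\equiv v' \bmod \mathfrak iV$. *)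

(* Defs.v *)
From HB Require Import structures.
From mathcomp Require Import all_boot all_order all_algebra all_fingroup all_character ring.

Set Implicit Arguments.
Unset Strict Implicit.
Unset Printing Implicit Defensive.

Import GRing.Theory.
Import Pdiv.CommonRing Pdiv.RingMonic.
Local Open Scope ring_scope.

Section FiniteCommutativeRings.
Variable R : finComNzRingType.
Implicit Types (I J M : {set R}) (a : R).

Definition is_ideal I : Prop :=
  [/\ 0 \in I,
      forall a b, a \in I -> b \in I -> a + b \in I
    & forall c a, a \in I -> c * a \in I].

Definition principal_ideal a : {set R} := [set c * a | c : R].

Definition principal_ideal_ring : Prop :=
  forall I, is_ideal I -> exists a, I = principal_ideal a.

Definition maximal_ideal M : Prop :=
  [/\ is_ideal M, M != setT
    & forall J, is_ideal J -> M \subset J -> J = M \/ J = setT].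

Definition local_ring_with_maximal_ideal M : Prop :=
  forall J, maximal_ideal J <-> J = M.

(* I^k is additively spanned by the products of k elements of I, so this says
   I^k = 0; for k = 0 the product is 1 and the condition fails. *)
Definition ideal_pow_eq0 I (k : nat) : Prop :=
  forall f : 'I_k -> R, (forall i, f i \in I) -> \prod_i f i = 0.

Definition nilpotency_degree I (k : nat) : Prop :=
  ideal_pow_eq0 I k /\ forall j, (j < k)%N -> ~ ideal_pow_eq0 I j.

Definition free_of_rank (V : lmodType R) (n : nat) : Prop :=
  exists b : 'I_n -> V,
    forall v : V, exists! c : {ffun 'I_n -> R}, v = \sum_i c i *: b i.

Section Characters.
Variable C : fieldType.
Implicit Type lam : R -> C.

(* Homomorphisms from (R, +) to the multiplicative group of C; the values are
   invertible since lam a * lam (- a) = 1. *)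
Definition additive_character lam : Prop :=
  lam 0 = 1 /\ forall a b, lam (a + b) = lam a * lam b.

Definition primitive_character lam : Prop :=
  forall I, is_ideal I -> (forall a, a \in I -> lam a = 1) -> I = [set 0].

End Characters.

End FiniteCommutativeRings.

Section RamifiedExtension.
Variables (R : finComNzRingType) (x : R).

Definition ramified_ext : predArgType := {poly %/ ('X^2 - x%:P : {poly R})}.

HB.instance Definition _ := GRing.ComNzRing.on ramified_ext.
HB.instance Definition _ := Finite.on ramified_ext.

Local Notation A := ramified_ext.

Definition ram_y : A := in_qpoly _ 'X.

(* ram_elt r s is r + s y; ram_re and ram_im are its coordinates r and s. *)
Definition ram_elt (r s : R) : A := in_qpoly _ (r%:P + s *: 'X).
Definition ram_re (a : A) : R := (polyn a)`_0.
Definition ram_im (a : A) : R := (polyn a)`_1.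

Definition ram_star (a : A) : A := ram_elt (ram_re a) (- ram_im a).
Definition ram_d (a : A) : R := ram_im a *+ 2.

Lemma size_ram_poly : size ('X^2 - x%:P : {poly R}) = 3%N.
Proof. by rewrite size_XnsubC. Qed.

Lemma monic_ram_poly : ('X^2 - x%:P : {poly R}) \is monic.
Proof. exact: monicXnsubC. Qed.

Lemma mk_monic_ram : mk_monic ('X^2 - x%:P : {poly R}) = 'X^2 - x%:P.
Proof. by rewrite /mk_monic size_ram_poly monic_ram_poly. Qed.

Lemma ram_eltE r s : ram_elt r s = r%:P + s *: 'X :> {poly R}.
Proof.
rewrite in_qpoly_small // mk_monic_ram size_ram_poly ltnS.
rewrite (leq_trans (size_polyD _ _)) // geq_max (leq_trans (size_polyC_leq1 _)) //=.
by rewrite (leq_trans (size_scale_leq _ _)) // size_polyX.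
Qed.

Lemma ram_re_elt r s : ram_re (ram_elt r s) = r.
Proof. by rewrite /ram_re ram_eltE coefD coefC coefZ coefX mulr0 addr0. Qed.

Lemma ram_im_elt r s : ram_im (ram_elt r s) = s.
Proof. by rewrite /ram_im ram_eltE coefD coefC coefZ coefX mulr1 add0r. Qed.

Lemma ram_eltK a : ram_elt (ram_re a) (ram_im a) = a.
Proof.
apply/val_inj; rewrite [LHS]ram_eltE; apply/polyP=> -[|[|i]].
- by rewrite coefD coefC coefZ coefX mulr0 addr0.
- by rewrite coefD coefC coefZ coefX mulr1 add0r.
rewrite coefD coefC coefZ coefX mulr0 addr0 nth_default //.
by rewrite (leq_trans (size_npoly _)) // mk_monic_ram size_ram_poly.
Qed.

Lemma ram_elt_mul r s r' s' :
  ram_elt r s * ram_elt r' s' = ram_elt (r * r' + x * (s * s')) (r * s' + s * r').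
Proof.
have -> : ram_elt r s * ram_elt r' s' = in_qpoly _ ((r%:P + s *: 'X) * (r'%:P + s' *: 'X)).
  by rewrite in_qpolyM.
have -> : (r%:P + s *: 'X) * (r'%:P + s' *: 'X) =
   (s * s')%:P * ('X^2 - x%:P) +
   ((r * r' + x * (s * s'))%:P + (r * s' + s * r') *: 'X).
  by rewrite -!mul_polyC !(polyCM, polyCD); ring.
rewrite linearD /= [X in X + _](_ : _ = 0) ?add0r //.
by apply/val_inj; rewrite /= mk_monic_ram rmodp_mull ?monic_ram_poly.
Qed.

Lemma ram_reD a b : ram_re (a + b) = ram_re a + ram_re b.
Proof. exact: coefD. Qed.

Lemma ram_imD a b : ram_im (a + b) = ram_im a + ram_im b.
Proof. exact: coefD. Qed.

Lemma ram_dD a b : ram_d (a + b) = ram_d a + ram_d b.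
Proof. by rewrite /ram_d ram_imD mulrnDl. Qed.

Lemma ram_starM a b : ram_star (a * b) = ram_star a * ram_star b.
Proof.
rewrite -{1}[a]ram_eltK -{1}[b]ram_eltK ram_elt_mul /ram_star ram_elt_mul.
by rewrite ram_re_elt ram_im_elt !mulrNN opprD mulrN mulNr.
Qed.

Lemma ram_star_d0 a : ram_star a = a -> ram_d a = 0.
Proof.
move/(congr1 ram_im); rewrite ram_im_elt => /esym/eqP.
by rewrite -addr_eq0 => /eqP.
Qed.

Lemma ram_yE : ram_y = ram_elt 0 1.
Proof. by rewrite /ram_elt scale1r add0r. Qed.

Lemma ram_y_star : ram_star ram_y * ram_y = ram_elt (- x) 0.
Proof.
rewrite ram_yE /ram_star ram_re_elt ram_im_elt ram_elt_mul.
by rewrite mulr0 add0r mulr1 mulrN1 mul0r mulr0 addr0.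
Qed.

Lemma ram_star1 : ram_star 1 = 1.
Proof.
have E : 1 = ram_elt 1 0 :> A.
  by apply/val_inj; rewrite [RHS]ram_eltE scale0r addr0.
by rewrite E /ram_star ram_re_elt ram_im_elt oppr0.
Qed.

Lemma ram_starX a n : ram_star (a ^+ n) = ram_star a ^+ n.
Proof. by elim: n => [|n IH]; rewrite ?ram_star1 // !exprS ram_starM IH. Qed.

Lemma ram_eltX r n : ram_elt r 0 ^+ n = ram_elt (r ^+ n) 0.
Proof.
elim: n => [|n IH].
  by apply/val_inj; rewrite [RHS]ram_eltE scale0r addr0.
by rewrite exprS IH ram_elt_mul !(mulr0, mul0r) !addr0 -exprS.
Qed.

Lemma ram_y_star_pow n : x ^+ n = 0 -> ram_star (ram_y ^+ n) * ram_y ^+ n = 0.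
Proof.
move=> xn; rewrite ram_starX -exprMn ram_y_star ram_eltX exprNn xn mulr0.
by apply/val_inj; rewrite [LHS]ram_eltE scale0r addr0.
Qed.

End RamifiedExtension.

Section UnitaryGroup.
Variables (R : finComNzRingType) (x : R).
Local Notation A := (ramified_ext x).
Variables (V : finLmodType A) (h : V -> V -> A).

Record nondegenerate_hermitian_form : Prop := NondegenerateHermitianForm {
  herm_Dl : forall u v w, h (u + v) w = h u w + h v w;
  herm_Dr : forall u v w, h u (v + w) = h u v + h u w;
  herm_Zr : forall (a : A) u v, h u (a *: v) = a * h u v;
  herm_sym : forall u v, h v u = ram_star (h u v);
  herm_nondeg : forall f : {scalar V}, exists! v, forall w, h v w = f w
}.

Definition unitary_set : {set {perm V}} :=
  [set g : {perm V} |
     [forall a : A, forall u : V, forall v : V,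
        g (a *: u + v) == a *: g u + g v]
  && [forall u : V, forall v : V, h (g u) (g v) == h u v]].

Lemma unitaryP (g : {perm V}) :
  reflect ((forall (a : A) u v, g (a *: u + v) = a *: g u + g v)
        /\ (forall u v, h (g u) (g v) = h u v))
          (g \in unitary_set).
Proof.
rewrite inE; apply: (iffP andP) => -[gL gh]; split.
- by move=> a u v; apply/eqP; move: gL => /forallP/(_ a)/forallP/(_ u)/forallP/(_ v).
- by move=> u v; apply/eqP; move: gh => /forallP/(_ u)/forallP/(_ v).
- by do 3!apply/forallP=> ?; rewrite gL.
- by do 2!apply/forallP=> ?; rewrite gh.
Qed.

Lemma unitary_group_set : group_set unitary_set.
Proof.
apply/group_setP; split; first by apply/unitaryP; split=> *; rewrite !perm1.
move=> f g /unitaryP[fL fh] /unitaryP[gL gh]; apply/unitaryP.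
by split=> *; rewrite !permM ?fL ?gL // gh fh.
Qed.

Definition unitary_group : {group {perm V}} := Group unitary_group_set.

End UnitaryGroup.

Section WeilModule.
Variables (R : finComNzRingType) (x : R) (M : {set R}) (ell : nat).
Local Notation A := (ramified_ext x).
Variables (V : finLmodType A) (h : V -> V -> A).
Variables (C : fieldType) (lam : R -> C).
Variable T : {set V}.

(* The set of products a *: v with a in the ideal generated by y ^+ ell is
   already a submodule, because the ideal is principal. *)
Definition iV : {set V} :=
  [set a *: v | a in principal_ideal (ram_y x ^+ ell), v in [set: V]].

Definition transversal_iV : Prop :=
  is_transversal T
    (equivalence_partition (fun u v : V => u - v \in iV) [set: V]) [set: V].

Definition mu (a : A) : C := lam (ram_d a).

(* Row i is the image under g of the basis vector e_v, v = enum_val i.  With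
   row vectors this is a representation for the product of permutations, which
   satisfies (f * g) v = g (f v); the submodules and the isomorphisms between
   them are those of the corresponding left module. *)
Definition weil_mx (g : {perm V}) : 'M[C]_#|T| :=
  \matrix_(i, j)
    let v := enum_val i in let v' := enum_val j in
    if g v - v' \in iV then mu (h (g v) v') else 0.

Hypothesis x_gen : M = principal_ideal x.
Hypothesis ell_nilp : nilpotency_degree M ell.
Hypothesis h_herm : nondegenerate_hermitian_form h.
Hypothesis lam_char : additive_character lam.
Hypothesis T_trans : transversal_iV.

Lemma weil_xX : x ^+ ell = 0.
Proof.
have [/(_ (fun=> x)) + _] := ell_nilp; rewrite prodr_const card_ord; apply=> _.
by rewrite x_gen; apply/imsetP; exists 1; rewrite ?mul1r.
Qed.

Lemma iVP u : reflect (exists w, u = ram_y x ^+ ell *: w) (u \in iV).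
Proof.
apply: (iffP imset2P) => [[a v /imsetP[c _ ->] _ ->]|[w ->]].
  by exists (c *: v); rewrite scalerA mulrC.
exists (ram_y x ^+ ell) w; rewrite ?inE //.
by apply/imsetP; exists 1; rewrite ?mul1r.
Qed.

Lemma iV0 : 0 \in iV.
Proof. by apply/iVP; exists 0; rewrite scaler0. Qed.

Lemma iVB u v : u \in iV -> v \in iV -> u - v \in iV.
Proof.
by move=> /iVP[u' ->] /iVP[v' ->]; apply/iVP; exists (u' - v'); rewrite scalerBr.
Qed.

Lemma iVN u : u \in iV -> - u \in iV.
Proof. by rewrite -sub0r => iu; rewrite iVB ?iV0. Qed.

Lemma iVD u v : u \in iV -> v \in iV -> u + v \in iV.
Proof. by move=> iu iv; rewrite -[v]opprK iVB ?iVN. Qed.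

Lemma iV_herm u v : u \in iV -> v \in iV -> h u v = 0.
Proof.
move=> /iVP[u' ->] /iVP[v' ->].
rewrite (herm_Zr h_herm) (herm_sym h_herm) (herm_Zr h_herm) ram_starM.
by rewrite mulrCA mulrA ram_y_star_pow ?mul0r // weil_xX.
Qed.

Lemma transversalP v :
  exists2 t, t \in T & forall t', t' \in T -> (v - t' \in iV) = (t' == t).
Proof.
have /and3P[_ _ /forallP/(_ [set w | v - w \in iV])] := T_trans.
rewrite (_ : _ \in _); last first.
  by apply/imsetP; exists v; rewrite ?inE //; apply/setP=> w; rewrite !inE.
move/cards1P=> [t /setP Et]; exists t.
  by have := Et t; rewrite !inE eqxx => /andP[].
by move=> t' Tt'; have := Et t'; rewrite !inE Tt'.
Qed.

Lemma muD a b : mu (a + b) = mu a * mu b.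
Proof. by rewrite /mu ram_dD lam_char.2. Qed.

Lemma mu_diag v : mu (h v v) = 1.
Proof.
by rewrite /mu ram_star_d0 ?lam_char.1 // -(herm_sym h_herm).
Qed.

Lemma weil_mx_repr : mx_repr (unitary_group h) weil_mx.
Proof.
split=> [|f g /unitaryP[fL fh] /unitaryP[gL gh]].
  apply/matrixP=> i j; rewrite !mxE /= perm1.
  have [t Tt tP] := transversalP (enum_val i).
  have := tP _ (enum_valP i); rewrite subrr iV0 => /esym/eqP Ei.
  rewrite tP ?enum_valP // -Ei (inj_eq enum_val_inj) eq_sym.
  by case: eqVneq => [->|//]; rewrite mu_diag.
apply/matrixP=> i k; rewrite !mxE /= permM; set v := enum_val i; set v'' := enum_val k.
have [t Tt tP] := transversalP (f v).
rewrite (bigD1 (enum_rank_in Tt t)) //= big1 => [|j nj]; last first.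
  rewrite !mxE /= -/v tP ?enum_valP //.
  case: eqP => [Ej|]; last by rewrite mul0r.
  by case/eqP: nj; apply: enum_val_inj; rewrite enum_rankK_in.
rewrite addr0 !mxE /= enum_rankK_in // -/v -/v'' tP // eqxx.
have i1 : f v - t \in iV by rewrite tP.
have gB u w : g (u - w) = g u - g w.
  by rewrite -scaleN1r addrC gL scaleN1r addrC.
have gi u : u \in iV -> g u \in iV.
  have g0 : g 0 = 0 by have := gB 0 0; rewrite !subrr.
  by case/iVP=> w ->; apply/iVP; exists (g w); rewrite -[_ *: w]addr0 gL g0 addr0.
have -> : (g (f v) - v'' \in iV) = (g t - v'' \in iV).
  have i2 : g (f v) - g t \in iV by rewrite -gB gi.
  apply/idP/idP=> [i3|i3].
    by have := iVB i3 i2; rewrite opprB addrC addrA subrK.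
  by have := iVD i2 i3; rewrite addrA subrK.
case: ifP => [i2|]; last by rewrite mulr0.
have hBl u w z : h (u - w) z = h u z - h w z.
  by apply/eqP; rewrite eq_sym subr_eq -(herm_Dl h_herm) subrK.
have hBr u w z : h z (u - w) = h z u - h z w.
  by apply/eqP; rewrite eq_sym subr_eq -(herm_Dr h_herm) subrK.
have E : h (g (f v)) v'' + h t t = h (f v) t + h (g t) v''.
  have : h (g (f v - t)) (g t - v'') = 0 by rewrite iV_herm ?gi.
  rewrite gB hBl !hBr !gh => /subr0_eq/eqP.
  by rewrite subr_eq addrAC eq_sym subr_eq addrC => /eqP.
by rewrite -muD -E muD mu_diag mulr1.
Qed.

Definition weil_module : mx_representation C (unitary_group h) #|T| :=
  MxRepresentation weil_mx_repr.

End WeilModule.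

(* The module is a direct sum of pairwise non-isomorphic simple submodules. *)
Definition multiplicity_free (F : fieldType) (gT : finGroupType)
    (G : {group gT}) (n : nat) (rG : mx_representation F G n) : Prop :=
  exists (I : finType) (W : I -> 'M[F]_n),
    [/\ forall i, mxsimple rG (W i),
        (\sum_i W i :=: 1%:M)%MS,
        mxdirect (\sum_i W i)
      & forall i j, mx_iso rG (W i) (W j) -> i = j].

(* Main.v *)
Require Import Defs.
From mathcomp Require Import all_boot all_order all_algebra all_fingroup all_character ring.
From mathcomp Require Import boolp reals.
From mathcomp.real_closed Require Import complex.

(* Let theta be the coordinatewise conjugation of V in an orthogonal basis.  Then
   h (theta u) (theta v) = h v u, and theta preserves each U-orbit: theta v is
   the image of v under a diagonal unitary map, because every a in A has the form
   u y^k with u a unit, so that a^* = ((-1)^k u^* / u) a, with a factor of norm 1.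

   The Schroedinger operators S(w) of the Heisenberg group of V act on X, span
   End(X) and satisfy g S(w) g^-1 = S(g w), so End_U(X) consists of the
   combinations of the S(w) whose coefficients are constant on the U-orbits.
   As S(w) S(z) is S(w + z) up to a factor that theta inverts, S(w) |-> S(theta w)
   is an anti-automorphism of End(X) that fixes End_U(X) pointwise.  Hence
   End_U(X) is commutative, and X is multiplicity free. *)

Set Implicit Arguments.
Unset Strict Implicit.
Unset Printing Implicit Defensive.

Import GRing.Theory.
Local Open Scope ring_scope.

(** * Semisimple modules with commutative endomorphism algebra *)

Lemma multiplicity_free_of_commutative_centralizer
    (F : fieldType) (gT : finGroupType) (G : {group gT}) (n : nat)
    (rG : mx_representation F G n) :
  #|G|%:R != 0 :> F ->
  (forall B B' : 'M[F]_n,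
     centgmx rG B -> centgmx rG B' -> B *m B' = B' *m B) ->
  multiplicity_free rG.
Proof.
move=> G_neq0 centC.
have red : mx_completely_reducible rG 1%:M.
  by apply: mx_Maschke_pchar; rewrite /pgroup.pgroup pcharf'_nat.
(* The decomposition into simples exists only under [classically]; [asboolP] makes the goal boolean,
   so that this can be eliminated. *)
apply/asboolP; apply: (mx_reducible_semisimple (mxmodule1 rG) red).
move=> [I W W_ simW sumW dxW]; apply/asboolP.
exists I, W; split=> // i j [f f_unit homf defWj].
apply/eqP/negPn/negP => neq_ij.
(* The projection P onto W i cannot commute with P f, as P (P f) = P f but
   (P f) P = 0. *)
pose W' := (\sum_(k | k != i) W k)%MS.
have dxWi : (W i :&: W' = 0)%MS.
  by move/mxdirect_sumsP: dxW => /(_ i isT).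
have modW k : mxmodule rG (W k) by case: (simW k).
have modW' : mxmodule rG W' by apply: sumsmx_module.
have sumWi : (W i + W' :=: 1%:M)%MS.
  by apply: eqmx_trans sumW; rewrite /W_ (bigD1 i).
pose P := proj_mx (W i) W'.
have PW : (P <= W i)%MS by rewrite -[P]mul1mx proj_mx_sub.
have /hom_mxP homP : (1%:M <= dom_hom_mx rG P)%MS.
  by rewrite -sumWi proj_mx_hom.
have centP : centgmx rG P.
  by apply/centgmxP=> x Gx; have := homP x Gx; rewrite !mul1mx.
have centPf : centgmx rG (P *m f).
  apply/centgmxP=> x Gx.
  have /hom_mxP <- // := submx_trans PW homf.
  by rewrite mulmxA; congr (_ *m f); apply: (centgmxP centP).
have PfP : P *m f *m P = 0.
  apply: proj_mx_0 => //; apply: submx_trans (submxMr f PW) _.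
  by rewrite defWj (sumsmx_sup j) // eq_sym.
have := centC _ _ centP centPf; rewrite PfP mulmxA proj_mx_proj // => Pf0.
have [_ nzWj _] := simW j; case/negP: nzWj.
by rewrite -(eqmx_eq0 defWj) -(proj_mx_id dxWi (submx_refl _)) -mulmxA Pf0 mulmx0.
Qed.

(** * Units of a finite local principal ring *)

Section ChainRing.
Variables (R : finComNzRingType) (M : {set R}).

Lemma principal_ideal_is_ideal (a : R) : is_ideal (principal_ideal a).
Proof.
split=> [|_ _ /imsetP[b _ ->] /imsetP[c _ ->]|c _ /imsetP[b _ ->]].
- by apply/imsetP; exists 0; rewrite ?mul0r.
- by apply/imsetP; exists (b + c); rewrite ?mulrDl.
- by apply/imsetP; exists (c * b); rewrite ?mulrA.
Qed.

(** If [r] generates a proper ideal, a proper principal ideal of largest cardinality among those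
    containing [r] is maximal, as all ideals are principal; hence it is [M]. *)
Lemma local_unit_or_in_maximal (r : R) :
  local_ring_with_maximal_ideal M -> principal_ideal_ring R ->
  (exists s, r * s = 1) \/ r \in M.
Proof.
move=> locM prinR.
have [rT|rT] := eqVneq (principal_ideal r) setT.
  have /imsetP[s _ E] : 1 \in principal_ideal r by rewrite rT inE.
  by left; exists s; rewrite mulrC.
have self a : a \in principal_ideal a by apply/imsetP; exists 1; rewrite ?mul1r.
right; pose P a := (r \in principal_ideal a) && (principal_ideal a != setT).
have Pr : P r by rewrite /P self.
case: (arg_maxnP (fun a => #|principal_ideal a|) Pr) => a /andP[ra aT] amax.
suff /locM <- : maximal_ideal (principal_ideal a) by [].
split=> // [|J /prinR[b ->] sab]; first exact: principal_ideal_is_ideal.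
have [->|bT] := eqVneq (principal_ideal b) setT; [by right | left].
apply/eqP; rewrite eq_sym eqEcard sab; apply: amax.
by rewrite /P bT (subsetP sab).
Qed.

End ChainRing.

(** * Arithmetic of the ramified extension A *)

Section RamifiedArithmetic.
Variables (R : finComNzRingType) (x : R).
Local Notation A := (ramified_ext x).
Local Notation y := (ram_y x).
Local Notation elt := (@ram_elt R x).
Implicit Types a b : A.

Lemma ram_inj a b : ram_re a = ram_re b -> ram_im a = ram_im b -> a = b.
Proof. by move=> re_ab im_ab; rewrite -[a]ram_eltK re_ab im_ab ram_eltK. Qed.

Lemma ram_re0 : ram_re (0 : A) = 0. Proof. exact: coef0. Qed.
Lemma ram_im0 : ram_im (0 : A) = 0. Proof. exact: coef0. Qed.

Lemma ram_elt1 : elt 1 0 = 1.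
Proof. by rewrite -(expr0 (elt 0 0)) ram_eltX expr0. Qed.

Lemma ram_re1 : ram_re (1 : A) = 1. Proof. by rewrite -ram_elt1 ram_re_elt. Qed.
Lemma ram_im1 : ram_im (1 : A) = 0. Proof. by rewrite -ram_elt1 ram_im_elt. Qed.

Lemma ram_reN a : ram_re (- a) = - ram_re a. Proof. exact: coefN. Qed.
Lemma ram_imN a : ram_im (- a) = - ram_im a. Proof. exact: coefN. Qed.

Lemma ram_mulE a b :
  a * b = elt (ram_re a * ram_re b + x * (ram_im a * ram_im b))
              (ram_re a * ram_im b + ram_im a * ram_re b).
Proof. by rewrite -ram_elt_mul !ram_eltK. Qed.

Lemma ram_reM a b : ram_re (a * b) = ram_re a * ram_re b + x * (ram_im a * ram_im b).
Proof. by rewrite ram_mulE ram_re_elt. Qed.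

Lemma ram_imM a b : ram_im (a * b) = ram_re a * ram_im b + ram_im a * ram_re b.
Proof. by rewrite ram_mulE ram_im_elt. Qed.

Lemma ram_re_star a : ram_re (ram_star a) = ram_re a.
Proof. exact: ram_re_elt. Qed.

Lemma ram_im_star a : ram_im (ram_star a) = - ram_im a.
Proof. exact: ram_im_elt. Qed.

Lemma ram_re_y : ram_re y = 0. Proof. by rewrite ram_yE ram_re_elt. Qed.
Lemma ram_im_y : ram_im y = 1. Proof. by rewrite ram_yE ram_im_elt. Qed.

Definition ramE := (ram_reD, ram_imD, ram_reN, ram_imN, ram_reM, ram_imM,
  ram_re_star, ram_im_star, ram_re0, ram_im0, ram_re1, ram_im1,
  ram_re_y, ram_im_y, ram_re_elt, ram_im_elt).

Lemma ram_star_y : ram_star y = - y.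
Proof. by apply: ram_inj; rewrite !ramE ?oppr0. Qed.

Lemma ram_starD a b : ram_star (a + b) = ram_star a + ram_star b.
Proof. by apply: ram_inj; rewrite !ramE ?opprD. Qed.

Lemma ram_star0 : ram_star 0 = 0 :> A.
Proof. by apply: ram_inj; rewrite !ramE ?oppr0. Qed.

Lemma ram_starK : involutive (@ram_star R x).
Proof. by move=> a; apply: ram_inj; rewrite !ramE ?opprK. Qed.

Lemma ram_d_star a : ram_d (ram_star a) = - ram_d a.
Proof. by rewrite /ram_d ram_im_star mulNrn. Qed.

Lemma ram_yX2 n : y ^+ (2 * n) = elt (x ^+ n) 0.
Proof.
rewrite exprM -ram_eltX; congr (_ ^+ n).
by apply: ram_inj; rewrite expr2 !ramE; ring.
Qed.

Section Char.
Variable p : nat.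
Hypotheses (R_char : p \in [pchar R]) (p_odd : odd p).

Lemma odd_pchar_half : exists r : R, r *+ 2 = 1.
Proof.
(* With p = 2k + 1, the inverse of 2 modulo p is -k. *)
exists (- (p./2)%:R); apply/eqP; rewrite mulNrn eq_sym -addr_eq0 -mulrnA.
have := odd_double_half p; rewrite p_odd muln2 => pE.
by rewrite -[X in X + _]/(1%:R) -natrD pE pcharf0.
Qed.

Lemma ram_half : exists a : A, a *+ 2 = 1.
Proof.
have [r r2] := odd_pchar_half; exists (elt r 0).
by apply: ram_inj; rewrite mulr2n !ramE ?addr0 -?mulr2n.
Qed.

Lemma ram_double_eq0 a : a *+ 2 = 0 -> a = 0.
Proof. by case: ram_half => c c2 a2; rewrite -[a]mul1r -c2 mulrnAl -mulrnAr a2 mulr0. Qed.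

End Char.

Section Local.
Variable ell : nat.
Hypothesis ell_gt0 : (0 < ell)%N.
Hypothesis unit_or_x : forall r : R, (exists s, r * s = 1) \/ exists s, r = s * x.
Hypothesis xX : x ^+ ell = 0.
Hypothesis xX1 : x ^+ ell.-1 != 0.

(** Here (r + x s) r' = 1 - z with z nilpotent, and the geometric series inverts 1 - z. *)
Lemma unit_addx (r s : R) : (exists r', r * r' = 1) -> exists t, (r + x * s) * t = 1.
Proof.
move=> [r' rr']; pose z := - (x * s * r').
have z0 : z ^+ ell = 0 by rewrite /z -!mulrA -mulrN exprMn xX mul0r.
exists (r' * \sum_(i < ell) z ^+ i).
transitivity ((r * r' - z) * \sum_(i < ell) z ^+ i); first by rewrite /z; ring.
by rewrite rr' -opprB mulNr -subrX1 z0 sub0r opprK.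
Qed.

(** If the R-coordinate of [a] is a unit, so is the norm of [a], which differs from its square by a
    multiple of x; then [ram_star a] over the norm inverts [a]. Otherwise x = y^2 divides that
    coordinate, and y divides [a]. *)
Lemma ram_unit_or_y (a : A) : (exists b, a * b = 1) \/ exists b, a = b * y.
Proof.
have [re_unit|[s re_a]] := unit_or_x (ram_re a).
  left; have [u re_u] := re_unit.
  have /(unit_addx (- ram_im a ^+ 2)) [t tP] : exists r', ram_re a ^+ 2 * r' = 1.
    by exists (u ^+ 2); rewrite -exprMn re_u expr1n.
  exists (ram_star a * elt t 0); apply: ram_inj; rewrite !ramE; last by ring.
  by rewrite -tP; ring.
right; exists (elt (ram_im a) s).
by apply: ram_inj; rewrite !ramE ?re_a; ring.
Qed.

Lemma ram_y_nilp : y ^+ (2 * ell) = 0.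
Proof. by rewrite ram_yX2 xX; apply: ram_inj; rewrite !ramE. Qed.

(** For [ell] = l + 1 this power is x^l y, whose coordinate along y is x^l. *)
Lemma ram_y_nilp_pred : y ^+ (2 * ell).-1 != 0.
Proof.
case: ell ell_gt0 xX1 => // l _; rewrite mulnS addSn exprS ram_yX2 /=.
apply: contra => /eqP /(congr1 (@ram_im R x)).
by rewrite !ramE mul0r mul1r add0r => ->.
Qed.

Lemma ram_factor (a : A) :
  exists k u, [/\ (k <= 2 * ell)%N, exists v, u * v = 1 & a = u * y ^+ k].
Proof.
suff : forall n, (exists k u, [/\ (k <= n)%N, exists v, u * v = 1 & a = u * y ^+ k])
               \/ exists b, a = b * y ^+ n.
  case/(_ (2 * ell)%N) => // -[b]; rewrite ram_y_nilp mulr0 => ->.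
  (* Zero is written with the unit 1 and the vanishing power of y. *)
  exists (2 * ell)%N, 1; split=> //; first by exists 1; rewrite mulr1.
  by rewrite ram_y_nilp mulr0.
elim=> [|n [[k [u [le_kn u_unit ->]]]|[b ->]]].
- by right; exists a; rewrite mulr1.
- by left; exists k, u; split; rewrite // leqW.
have [b_unit|[c ->]] := ram_unit_or_y b; first by left; exists n, b.
by right; exists c; rewrite exprS mulrA.
Qed.

(** For a = u y^j with u a unit, the product is zero only if y^(k + j) = 0, which forces k + j to be
    at least 2 [ell]. *)
Lemma ram_ann_y (k : nat) (a : A) :
  (k <= 2 * ell)%N -> y ^+ k * a = 0 -> exists b, a = y ^+ (2 * ell - k) * b.
Proof.
move=> le_k; have [j [u [_ [v uv] ->]]] := ram_factor a => yku0.
have ykj0 : y ^+ (k + j) = 0.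
  transitivity (y ^+ k * (u * y ^+ j) * v); last by rewrite yku0 mul0r.
  by rewrite -[LHS]mulr1 -uv exprD; ring.
have le_j : (2 * ell - k <= j)%N.
  rewrite leq_subLR leqNgt; apply/negP => lt_kj; case/negP: ram_y_nilp_pred.
  have le_kj : (k + j <= (2 * ell).-1)%N by rewrite -ltnS prednK // (leq_ltn_trans _ lt_kj).
  by rewrite -(subnK le_kj) exprD ykj0 mulr0.
by exists (u * y ^+ (j - (2 * ell - k))); rewrite mulrCA -exprD subnKC.
Qed.

(* If a = u y^k with u a unit, then (-1)^k u^* / u has norm 1 and maps a to a^*. *)
Lemma ram_star_norm1 (a : A) : exists g, ram_star g * g = 1 /\ ram_star a = g * a.
Proof.
have [k [u [_ [v uv] ->]]] := ram_factor a.
have suv : ram_star u * ram_star v = 1 by rewrite -ram_starM uv ram_star1.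
exists ((-1) ^+ k * ram_star u * v); split.
  have sN1 : ram_star (-1) = -1 :> A by apply: ram_inj; rewrite !ramE ?oppr0.
  rewrite !ram_starM ram_starX sN1 ram_starK.
  transitivity (((-1) ^+ k * (-1) ^+ k) * (u * v) * (ram_star u * ram_star v)); first by ring.
  by rewrite -exprMn mulrNN mulr1 expr1n uv suv !mulr1.
rewrite ram_starM ram_starX ram_star_y [(- y) ^+ k]exprNn.
transitivity ((-1) ^+ k * ram_star u * (u * v) * y ^+ k); last by ring.
by rewrite uv mulr1; ring.
Qed.

End Local.
End RamifiedArithmetic.

(** * Hermitian forms and conjugation in an orthogonal basis *)

Section HermitianForm.
Variables (R : finComNzRingType) (x : R).
Local Notation A := (ramified_ext x).
Local Notation y := (ram_y x).
Variables (V : finLmodType A) (h : V -> V -> A).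
Hypothesis h_herm : nondegenerate_hermitian_form h.
Implicit Types (a b : A) (u v w : V).

Lemma hermZl a u v : h (a *: u) v = ram_star a * h u v.
Proof. by rewrite (herm_sym h_herm) (herm_Zr h_herm) ram_starM -(herm_sym h_herm). Qed.

Lemma herm0r u : h u 0 = 0.
Proof. by rewrite -(scale0r 0) (herm_Zr h_herm) mul0r. Qed.

Lemma herm0l u : h 0 u = 0.
Proof. by rewrite (herm_sym h_herm) herm0r ram_star0. Qed.

Lemma hermBr u v w : h w (u - v) = h w u - h w v.
Proof. by rewrite (herm_Dr h_herm) -scaleN1r (herm_Zr h_herm) mulN1r. Qed.

Lemma hermBl u v w : h (u - v) w = h u w - h v w.
Proof. by apply/eqP; rewrite eq_sym subr_eq -(herm_Dl h_herm) subrK. Qed.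

Lemma herm_sumr (I : Type) (r : seq I) (P : pred I) (F : I -> V) u :
  h u (\sum_(i <- r | P i) F i) = \sum_(i <- r | P i) h u (F i).
Proof. by apply: (big_morph (h u) _ (herm0r u)) => v w; exact: herm_Dr. Qed.

Lemma herm_suml (I : Type) (r : seq I) (P : pred I) (F : I -> V) u :
  h (\sum_(i <- r | P i) F i) u = \sum_(i <- r | P i) h (F i) u.
Proof.
by apply: (big_morph (h^~ u) _ (herm0l u)) => v w; exact: herm_Dl.
Qed.

(** Both [u] and 0 represent the zero functional, and the representing vector is unique. *)
Lemma herm_orthogonal_eq0 u : (forall v, h v u = 0) -> u = 0.
Proof.
move=> hu0; have [u0 [_ uniq_u0]] := herm_nondeg h_herm (GRing.null_fun A).
rewrite -(uniq_u0 u) ?(uniq_u0 0) // => v; first by rewrite herm0l.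
by rewrite (herm_sym h_herm) hu0 ram_star0.
Qed.

Lemma unitary_of_isometry (f : V -> V) :
    (forall a u v, f (a *: u + v) = a *: f u + f v) ->
    (forall u v, h (f u) (f v) = h u v) ->
  exists2 g, g \in unitary_group h & g =1 f.
Proof.
move=> f_lin f_iso; have f_inj : injective f.
  move=> u v fuv; apply/eqP; rewrite -subr_eq0; apply/eqP.
  apply: herm_orthogonal_eq0 => w.
  by rewrite hermBr -!(f_iso w) fuv subrr.
exists (perm f_inj) => [|u]; last by rewrite permE.
by apply/unitaryP; split=> [a u v|u v]; rewrite !permE ?f_lin ?f_iso.
Qed.

Section OrthogonalBasis.
Variable S : {set V}.
Hypothesis S_orth : {in S &, forall v w, v != w -> h v w = 0}.
Variable inv_norm : V -> A.
Hypothesis inv_normP : {in S, forall v, h v v * inv_norm v = 1}.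

Definition orth_coef v u : A := inv_norm v * h v u.

Lemma herm_comb v (c : V -> A) :
  v \in S -> h v (\sum_(w in S) c w *: w) = c v * h v v.
Proof.
move=> Sv; rewrite herm_sumr (bigD1 v) //= (herm_Zr h_herm) big1 ?addr0 //.
by move=> w /andP[Sw wv]; rewrite (herm_Zr h_herm) S_orth ?mulr0 // eq_sym.
Qed.

Lemma orth_coef_comb v (c : V -> A) :
  v \in S -> orth_coef v (\sum_(w in S) c w *: w) = c v.
Proof.
by move=> Sv; rewrite /orth_coef herm_comb // mulrCA [_ * h v v]mulrC inv_normP ?mulr1.
Qed.

Lemma herm_comb2 (b c : V -> A) :
  h (\sum_(w in S) b w *: w) (\sum_(w in S) c w *: w) =
  \sum_(w in S) ram_star (b w) * c w * h w w.
Proof.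
by rewrite herm_suml; apply: eq_bigr => v Sv; rewrite hermZl herm_comb ?mulrA.
Qed.

Lemma orth_coef_lin a v u w : orth_coef v (a *: u + w) = a * orth_coef v u + orth_coef v w.
Proof. by rewrite /orth_coef (herm_Dr h_herm) (herm_Zr h_herm) mulrDr mulrCA. Qed.

Hypothesis S_span : forall u, u = \sum_(v in S) orth_coef v u *: v.

Lemma herm_coef u w :
  h u w = \sum_(v in S) ram_star (orth_coef v u) * orth_coef v w * h v v.
Proof. by rewrite {1}(S_span u) {1}(S_span w) herm_comb2. Qed.

(** This is theta, the coordinatewise conjugation. *)
Definition orth_conj u : V := \sum_(v in S) ram_star (orth_coef v u) *: v.

Lemma orth_conjD u w : orth_conj (u + w) = orth_conj u + orth_conj w.
Proof.
rewrite -big_split; apply: eq_bigr => v _ /=.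
by rewrite -[u]scale1r orth_coef_lin mul1r scale1r ram_starD scalerDl.
Qed.

Lemma orth_conjK : involutive orth_conj.
Proof.
move=> u; rewrite [RHS]S_span; apply: eq_bigr => v Sv.
by rewrite orth_coef_comb // ram_starK.
Qed.

Lemma herm_orth_conj u w : h (orth_conj u) (orth_conj w) = h w u.
Proof.
rewrite herm_comb2 [RHS]herm_coef; apply: eq_bigr => v _.
by rewrite ram_starK; congr (_ * _); rewrite mulrC.
Qed.

Hypothesis star_norm1 : forall a, exists g, ram_star g * g = 1 /\ ram_star a = g * a.

Lemma orth_conj_orbit u : exists2 g, g \in unitary_group h & g u = orth_conj u.
Proof.
have /fin_all_exists[c cP] v := star_norm1 (orth_coef v u).
(* The diagonal map whose entries are the norm 1 factors conjugating the coordinates of this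
   particular [u]. *)
pose f w := \sum_(v in S) (c v * orth_coef v w) *: v.
have [||g Ug gf] := @unitary_of_isometry f.
- move=> a w w'; rewrite scaler_sumr -big_split; apply: eq_bigr => v _ /=.
  by rewrite orth_coef_lin mulrDr scalerDl scalerA mulrCA.
- move=> w w'; rewrite herm_comb2 [RHS]herm_coef; apply: eq_bigr => v _.
  congr (_ * _); rewrite ram_starM mulrACA; have [-> _] := cP v.
  by rewrite mul1r.
exists g => //; rewrite gf; apply: eq_bigr => v _.
by have [_ ->] := cP v.
Qed.

End OrthogonalBasis.

(** * Existence of an orthogonal basis *)

Section OrthogonalBasisExistence.
Variables (m ell : nat).
Hypothesis V_free : free_of_rank V m.
Hypothesis ell_gt0 : (0 < ell)%N.
Hypothesis half : exists a : A, a *+ 2 = 1.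
Hypothesis unit_or_y : forall a, (exists b, a * b = 1) \/ exists b, a = b * y.
Hypothesis y_nilp : y ^+ (2 * ell) = 0.
Hypothesis ann_y : forall k a,
  (k <= 2 * ell)%N -> y ^+ k * a = 0 -> exists b, a = y ^+ (2 * ell - k) * b.

Lemma ann_y_free (k : nat) v :
  (k <= 2 * ell)%N -> y ^+ k *: v = 0 -> exists w, v = y ^+ (2 * ell - k) *: w.
Proof.
move=> le_k; have [b bP] := V_free.
have [c [-> _]] := bP v => yv0.
have yc0 i : y ^+ k * c i = 0.
  have [c0 [_ c0_uniq]] := bP 0.
  have c0_0 : c0 = [ffun=> 0].
    by apply: c0_uniq; rewrite big1 // => j _; rewrite ffunE scale0r.
  have c0_yc : c0 = [ffun j => y ^+ k * c j].
    apply: c0_uniq; rewrite -[LHS]yv0 scaler_sumr; apply: eq_bigr => j _.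
    by rewrite ffunE scalerA.
  by have /ffunP/(_ i) := etrans (esym c0_yc) c0_0; rewrite !ffunE.
have /fin_all_exists[d dP] i := ann_y le_k (yc0 i).
exists (\sum_i d i *: b i); rewrite scaler_sumr.
by apply: eq_bigr => i _; rewrite scalerA -dP.
Qed.

(** A total choice of inverse, with value 0 on non-units, from which the inverse norms of basis
    vectors are obtained. *)
Definition ram_inv a : A := odflt 0 [pick b | a * b == 1].

Lemma ram_invP a : (exists b, a * b = 1) -> a * ram_inv a = 1.
Proof.
by rewrite /ram_inv => -[b ab]; case: pickP => [c /eqP //|/(_ b)]; rewrite ab eqxx.
Qed.

(** The norms of u, w and u + w lie in Ay, hence so does h u w plus its conjugate. Their difference
    is 2 [ram_im (h u w)] y, also in Ay, and 2 is invertible. *)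
Lemma herm_polarization u w :
    (forall a b, ~ exists c, h (a *: u + b *: w) (a *: u + b *: w) * c = 1) ->
  exists c, h u w = c * y.
Proof.
move=> norm_nonunit.
have norm_y a b : exists c, h (a *: u + b *: w) (a *: u + b *: w) = c * y.
  by case: (unit_or_y (h (a *: u + b *: w) (a *: u + b *: w))) => // /norm_nonunit.
have [c1] := norm_y 1 0; have [c2] := norm_y 0 1; have [c3] := norm_y 1 1.
rewrite !scale1r !scale0r addr0 add0r !(herm_Dl h_herm) !(herm_Dr h_herm).
rewrite (herm_sym h_herm u w) => E3 E2 E1.
have [e eP] : exists e, h u w - ram_star (h u w) = e * y.
  exists (ram_elt x (ram_im (h u w) *+ 2) 0).
  by apply: ram_inj; rewrite !ramE; ring.
have [t t2] := half; exists (t * (c3 - c1 - c2 + e)).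
have -> : h u w = t * (h u w *+ 2) by rewrite mulrnAr -mulrnAl t2 mul1r.
rewrite -mulrA; congr (_ * _).
rewrite !mulrDl !mulNr -E3 -E2 -E1 -eP; ring.
Qed.

(* A maximal orthogonal set of vectors of unit norm spans V: otherwise its
   orthogonal complement, a non-zero direct summand, would contain no vector of
   unit norm, and the last non-zero power of y would map it to the radical of h. *)
Lemma exists_orthogonal_basis : exists S : {set V},
  [/\ {in S &, forall v w, v != w -> h v w = 0},
      {in S, forall v, h v v * ram_inv (h v v) = 1}
    & forall u, u = \sum_(v in S) orth_coef (fun v => ram_inv (h v v)) v u *: v].
Proof.
pose P (S : {set V}) :=
  [forall v in S, (h v v * ram_inv (h v v) == 1)
     && [forall w in S, (v != w) ==> (h v w == 0)]].
have P0 : P set0 by apply/forallP=> v; rewrite inE.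
case: (arg_maxnP (fun S : {set V} => #|S|) P0) => S PS Smax; exists S.
have S_norm : {in S, forall v, h v v * ram_inv (h v v) = 1}.
  by move=> v Sv; have /forall_inP/(_ v Sv)/andP[/eqP] := PS.
have S_orth : {in S &, forall v w, v != w -> h v w = 0}.
  move=> v w Sv Sw vw; have /forall_inP/(_ v Sv)/andP[_] := PS.
  by move=> /forall_inP/(_ w Sw)/implyP/(_ vw)/eqP.
split=> // u0; pose cf := orth_coef (fun v => ram_inv (h v v)).
(* [res] is the projection onto the orthogonal complement of S. *)
pose res u := u - \sum_(v in S) cf v u *: v.
have res_orth v u : v \in S -> h v (res u) = 0.
  move=> Sv; rewrite hermBr herm_comb // /cf /orth_coef mulrAC.
  by rewrite [_ * h v v]mulrC S_norm // mul1r subrr.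
have orth_res w : (forall v, v \in S -> h v w = 0) -> res w = w.
  move=> ow; rewrite /res big1 ?subr0 // => v Sv.
  by rewrite /cf /orth_coef ow // mulr0 scale0r.
(* A vector of unit norm orthogonal to S could be added to S, against maximality. *)
have norm_nonunit z : (forall v, v \in S -> h v z = 0) -> ~ exists c, h z z * c = 1.
  move=> oz z_unit.
  have zS : z \notin S.
    apply/negP => Sz; have [c] := z_unit; rewrite oz // mul0r => /eqP.
    by rewrite eq_sym oner_eq0.
  have : P (z |: S).
    apply/forall_inP=> v; rewrite in_setU1 => /predU1P[->|Sv].
      rewrite ram_invP // eqxx; apply/forall_inP=> w.
      rewrite in_setU1 => /predU1P[->|Sw]; first by rewrite eqxx.
      by rewrite (herm_sym h_herm) oz // ram_star0 eqxx implybT.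
    rewrite S_norm // eqxx; apply/forall_inP=> w.
    rewrite in_setU1 => /predU1P[->|Sw]; first by rewrite oz // eqxx implybT.
    by apply/implyP=> vw; rewrite S_orth.
  by move/Smax; rewrite /= cardsU1 zS add1n ltnn.
apply/eqP; rewrite -subr_eq0 -/cf -/(res u0); apply/negPn/negP => w_neq0.
pose w := res u0.
(* The largest j with w in y^j V exists because y is nilpotent and w is non-zero; dividing z by y
   once more will contradict its choice. *)
pose D j := [exists w', w == y ^+ j *: w'].
have D0 : exists j, D j by exists 0%N; apply/existsP; exists w; rewrite expr0 scale1r.
have Dle j : D j -> (j <= 2 * ell)%N.
  case/existsP=> w' /eqP wE; rewrite leqNgt; apply/negP=> lt_j; case/eqP: w_neq0.
  by rewrite -/w wE -(subnK (ltnW lt_j)) exprD y_nilp mulr0 scale0r.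
case: (ex_maxnP D0 Dle) => j /existsP[w' /eqP wE] jmax.
(* Projecting the cofactor keeps w = y^j z, since [res] is linear and fixes w, and puts z in the
   complement of S. *)
pose z := res w'.
have wz : w = y ^+ j *: z.
  rewrite -[LHS]orth_res => [|v Sv]; last exact: res_orth.
  rewrite wE /z /res scalerBr; congr (_ - _).
  rewrite scaler_sumr; apply: eq_bigr => v _.
  by rewrite /cf /orth_coef (herm_Zr h_herm) scalerA mulrCA.
have yz0 : y ^+ (2 * ell).-1 *: z = 0.
  apply: herm_orthogonal_eq0 => v; rewrite (herm_Zr h_herm).
  have -> : h v z = h (res v) z.
    rewrite hermBl herm_suml big1 ?subr0 // => s Ss.
    by rewrite hermZl res_orth // mulr0.
  have [a b|c ->] := @herm_polarization (res v) z.
    apply: norm_nonunit => s Ss.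
    by rewrite (herm_Dr h_herm) !(herm_Zr h_herm) !res_orth // !mulr0 addr0.
  by rewrite mulrCA -exprSr prednK ?muln_gt0 // y_nilp mulr0.
have [|z' zE] := ann_y_free _ yz0; first exact: leq_pred.
have : (j < j)%N; last by rewrite ltnn.
apply: jmax; apply/existsP; exists z'; rewrite wz zE scalerA -exprD.
rewrite (_ : 2 * ell - _ = 1)%N ?addn1 //.
by rewrite -[X in (X - _)%N](@prednK (2 * ell)) ?muln_gt0 // subSnn.
Qed.

Hypothesis star_norm1 : forall a, exists g, ram_star g * g = 1 /\ ram_star a = g * a.

(* If theta is the coordinatewise conjugation in an orthogonal basis and g in U
   satisfies g w = theta w, then sigma = g^-1 theta reverses h, fixes w and
   preserves the U-orbits. *)
Lemma exists_orbit_preserving_anti_isometry w : exists s : V -> V,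
  [/\ bijective s, {morph s : u v / u - v}, s w = w,
      forall u v, h (s u) (s v) = h v u
    & forall u, exists2 g, g \in unitary_group h & g u = s u].
Proof.
have [S [S_orth S_norm S_span]] := exists_orthogonal_basis.
pose t := orth_conj S (fun v => ram_inv (h v v)).
have t_orbit u : exists2 g, g \in unitary_group h & g u = t u.
  exact: orth_conj_orbit.
have tD u v : t (u + v) = t u + t v by exact: orth_conjD.
have tK : involutive t by exact: orth_conjK.
have th u v : h (t u) (t v) = h v u by exact: herm_orth_conj.
have [g Ug gw] := t_orbit w.
have Ugi := groupVr Ug; have /unitaryP[giL gih] := Ugi.
exists (fun u => g^-1%g (t u)); split.
- exact: bij_comp (Bijective (permKV g) (permK g)) (inv_bij tK).
- move=> u v.
  have tB : t u = 1 *: t (u - v) + t v by rewrite scale1r -tD subrK.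
  by rewrite tB giL scale1r addrK.
- by rewrite -gw permK.
- by move=> u v; rewrite gih th.
move=> u; have [k Uk ku] := t_orbit u.
by exists (k * g^-1)%g; rewrite ?groupM // permM ku.
Qed.

End OrthogonalBasisExistence.
End HermitianForm.

(** * Heisenberg operators on the Weil module *)

Section HeisenbergOperators.
Variables (R : finComNzRingType) (x : R) (M : {set R}) (ell : nat).
Local Notation A := (ramified_ext x).
Local Notation y := (ram_y x).
Variables (V : finLmodType A) (h : V -> V -> A).
Variables (C : fieldType) (lam : R -> C) (T : {set V}).
Hypothesis x_gen : M = principal_ideal x.
Hypothesis ell_nilp : nilpotency_degree M ell.
Hypothesis h_herm : nondegenerate_hermitian_form h.
Hypothesis lam_char : additive_character lam.
Hypothesis T_trans : transversal_iV ell T.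

Local Notation X := (weil_module x_gen ell_nilp h_herm lam_char T_trans).
Local Notation U := (unitary_group h).
Local Notation iV := (@iV R x ell V).
Local Notation mu := (@mu R x C lam).
Local Notation t_ i := (enum_val (i : 'I_#|T|)).
Implicit Types (u v w k z : V) (g : {perm V}).

Let hmu a b := muD lam_char (a : A) (b : A).
Let hDl := herm_Dl h_herm.
Let hDr := herm_Dr h_herm.
Let iVh := iV_herm x_gen ell_nilp h_herm.

Lemma mu_star (a : A) : mu (ram_star a) * mu a = 1.
Proof. by rewrite -hmu /Defs.mu ram_dD ram_d_star addNr lam_char.1. Qed.

Lemma mu_neq0 (a : A) : mu a != 0.
Proof.
by apply/eqP => mu0; have := mu_star a; rewrite mu0 mulr0 => /eqP; rewrite eq_sym oner_eq0.
Qed.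

(* The vector e_v of the Weil module, extended from T to all v in V. *)
Definition weil_vec v : 'rV[C]_#|T| :=
  \row_j (if v - t_ j \in iV then mu (h v (t_ j)) else 0).

Lemma unitaryB g u v : g \in U -> g (u - v) = g u - g v.
Proof.
by move=> /unitaryP[gL _]; rewrite -scaleN1r addrC gL scaleN1r addrC.
Qed.

Lemma unitaryD g u v : g \in U -> g (u + v) = g u + g v.
Proof. by move=> /unitaryP[gL _]; rewrite -[u in LHS]scale1r gL scale1r. Qed.

Lemma unitary_iV g k : g \in U -> k \in iV -> g k \in iV.
Proof.
move=> Ug /iVP[w ->]; apply/iVP; exists (g w).
have g0 : g 0 = 0 by rewrite -[X in g X](subrr 0) unitaryB // subrr.
by case/unitaryP: Ug => gL _; rewrite -[_ *: w]addr0 gL g0 addr0.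
Qed.

Lemma iV_addr u k : k \in iV -> (u + k \in iV) = (u \in iV).
Proof.
move=> ik; apply/idP/idP => iu; last exact: iVD.
by rewrite -(addrK k u) iVB.
Qed.

(** Where the entry is non-zero, v - t lies in iV, and h vanishes on iV, so h k t = h k v. *)
Lemma weil_vecD_iV v k : k \in iV -> weil_vec (v + k) = mu (h k v) *: weil_vec v.
Proof.
move=> ik; apply/rowP=> j; rewrite !mxE addrAC (iV_addr _ ik).
case: ifP => [iv|_]; last by rewrite mulr0.
rewrite -hmu hDl addrC; congr (mu (_ + _)).
by apply/eqP; rewrite -subr_eq0 -hermBr // iVh // -opprB iVN.
Qed.

Lemma row_weil_mx i g : row i (X g) = weil_vec (g (t_ i)).
Proof. by apply/rowP=> j; rewrite !mxE. Qed.

Lemma weil_vec_enum i : weil_vec (t_ i) = delta_mx 0 i.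
Proof. by have := row_weil_mx i 1%g; rewrite repr_mx1 row1 perm1 => ->. Qed.

Lemma transversal_decomp v : exists i k, k \in iV /\ v = t_ i + k.
Proof.
have [t Tt tP] := Defs.transversalP T_trans v.
exists (enum_rank_in Tt t), (v - t).
split; first by rewrite tP // eqxx.
by rewrite enum_rankK_in // addrC subrK.
Qed.

Lemma weil_vec_spans (B B' : 'M[C]_#|T|) :
  (forall v, weil_vec v *m B = weil_vec v *m B') -> B = B'.
Proof.
by move=> eqB; apply/row_matrixP=> i; rewrite !rowE -weil_vec_enum eqB.
Qed.

Lemma weil_vecM g v : g \in U -> weil_vec v *m X g = weil_vec (g v).
Proof.
move=> Ug; have [i [k [ik ->]]] := transversal_decomp v.
rewrite weil_vecD_iV // unitaryD // weil_vecD_iV ?unitary_iV //.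
rewrite -scalemxAl weil_vec_enum -rowE row_weil_mx.
by case/unitaryP: Ug => _ ->.
Qed.

(* The Schroedinger operators e_v |-> mu (h w v) e_(v + w) of the Heisenberg
   group of V. *)
Definition heis_op w : 'M[C]_#|T| :=
  \matrix_(i < #|T|) (mu (h w (t_ i)) *: weil_vec (t_ i + w)).

(** For v in T this is the definition. Moving v by k in iV costs an extra factor mu (h w k) mu (h k
    w), which is 1 because the two values of h are conjugate. *)
Lemma weil_vec_op v w : weil_vec v *m heis_op w = mu (h w v) *: weil_vec (v + w).
Proof.
have [i [k [ik ->]]] := transversal_decomp v.
rewrite weil_vecD_iV // -scalemxAl weil_vec_enum -rowE rowK addrAC (weil_vecD_iV (_ + w) ik).
rewrite !scalerA; congr (_ *: _); rewrite !hDr !hmu.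
rewrite -(mulr1 (_ * _)) -(mu_star (h k w)) -(herm_sym h_herm); ring.
Qed.

Lemma heis_opM w z : heis_op z *m heis_op w = mu (h w z) *: heis_op (z + w).
Proof.
apply: weil_vec_spans => v.
rewrite mulmxA weil_vec_op -scalemxAl weil_vec_op -scalemxAr weil_vec_op !scalerA.
by rewrite addrA hDr hDl !hmu; congr (_ *: _); ring.
Qed.

Lemma heis_opJ g w : g \in U -> X g^-1%g *m heis_op w *m X g = heis_op (g w).
Proof.
move=> Ug; apply: weil_vec_spans => v.
rewrite !mulmxA weil_vecM ?groupV // weil_vec_op -scalemxAl weil_vecM //.
rewrite unitaryD // permKV weil_vec_op; congr (mu _ *: _).
by case/unitaryP: Ug => _ <-; rewrite permKV.
Qed.

Definition heis_sum (f : V -> C) : 'M[C]_#|T| := \sum_w f w *: heis_op w.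

Lemma heis_sumM (f f' : V -> C) :
  heis_sum f *m heis_sum f' =
  heis_sum (fun w => \sum_z f z * f' (w - z) * mu (h (w - z) z)).
Proof.
rewrite mulmx_suml.
under eq_bigr => z _.
  rewrite mulmx_sumr (reindex (fun w => w - z)) /=; last first.
    by exists (fun w => w + z) => w _; rewrite ?subrK ?addrK.
  under eq_bigr => w _ do
    rewrite -scalemxAl -scalemxAr heis_opM (addrC z) subrK !scalerA.
  over.
rewrite exchange_big; apply: eq_bigr => w _ /=.
by rewrite -scaler_suml.
Qed.

(** The coefficients at each w are compared with a map s fixing w: the substitution of s z for z
    preserves f z and f' (w - z) and swaps the arguments of h, and replacing z by w - z in the other
    product gives the same sum. *)
Lemma heis_sum_comm (f f' : V -> C) :
    (forall g w, g \in U -> f (g w) = f w) ->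
    (forall g w, g \in U -> f' (g w) = f' w) ->
    (forall w, exists s : V -> V,
       [/\ bijective s, {morph s : u v / u - v}, s w = w,
           forall u v, h (s u) (s v) = h v u
         & forall u, exists2 g, g \in U & g u = s u]) ->
  heis_sum f *m heis_sum f' = heis_sum f' *m heis_sum f.
Proof.
move=> fU f'U anti; rewrite !heis_sumM; apply: eq_bigr => w _; congr (_ *: _).
have [s [s_bij sB sw sh s_orbit]] := anti w.
have inv_s (k : V -> C) : (forall g u, g \in U -> k (g u) = k u) -> forall u, k (s u) = k u.
  by move=> kU u; have [g Ug <-] := s_orbit u; rewrite kU.
rewrite (reindex s) /=; last exact: onW_bij.
rewrite [RHS](reindex_inj (can_inj (subKr w))) /=; apply: eq_bigr => z _.
by rewrite subKr -{1 2}sw -sB !inv_s // sh [f z * _]mulrC.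
Qed.

(** * The Heisenberg operators span End(X) *)

Section Spanning.
Variable p : nat.
Hypotheses (R_char : p \in [pchar R]) (p_odd : odd p).
Hypothesis lam_prim : primitive_character lam.
Hypothesis C_char0 : forall n, (0 < n)%N -> n%:R != 0 :> C.
Hypothesis ann_iV : forall u, y ^+ ell *: u = 0 -> u \in iV.

(** Multipliers from R show that lam is trivial on the ideal generated by [ram_d b], so [ram_im b] =
    0 by primitivity and invertibility of 2. The same argument for y b kills [ram_re b]. *)
Lemma mu_ideal_eq0 (b : A) : (forall a : A, mu (a * b) = 1) -> b = 0.
Proof.
have im0 (c : A) : (forall a : A, mu (a * c) = 1) -> ram_im c = 0.
  move=> mu1; have /setP/(_ (ram_d c)) : principal_ideal (ram_d c) = [set 0].
    apply: lam_prim => [|_ /imsetP[r _ ->]]; first exact: principal_ideal_is_ideal.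
    rewrite -[RHS](mu1 (ram_elt x r 0)) /Defs.mu /ram_d !ramE.
    by rewrite mul0r addr0 mulrnAr.
  rewrite inE; have -> : ram_d c \in principal_ideal (ram_d c).
    by apply/imsetP; exists 1; rewrite ?mul1r.
  move=> /esym/eqP d0; have [r r2] := odd_pchar_half R_char p_odd.
  by rewrite -[LHS]mul1r -r2 mulrnAl -mulrnAr -/(ram_d c) d0 mulr0.
move=> mu1; apply: ram_inj; rewrite ?ram_re0 ?ram_im0; last exact: im0.
have <- : ram_im (y * b) = ram_re b by rewrite !ramE; ring.
by apply: im0 => a; rewrite mulrA.
Qed.

(** The hypothesis makes mu trivial on the ideal generated by 2 y^ell h v u for every v, so y^ell u
    is orthogonal to V and vanishes. *)
Lemma iV_char_separates u : (forall k, k \in iV -> mu (h k u *+ 2) = 1) -> u \in iV.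
Proof.
move=> mu1; apply: ann_iV; apply: (herm_orthogonal_eq0 h_herm) => v.
rewrite (herm_Zr h_herm); apply: (ram_double_eq0 R_char p_odd).
apply: mu_ideal_eq0 => a.
(* The sign cancels the one in (y^ell)^* = (-1)^ell y^ell, as h is conjugate-linear on the left. *)
have -> : a * ((y ^+ ell * h v u) *+ 2)
          = h (y ^+ ell *: ((-1) ^+ ell * ram_star a *: v)) u *+ 2.
  rewrite -mulrnAr !(hermZl h_herm) ram_starM !ram_starX ram_star_y ram_starK.
  have -> : ram_star (-1) = -1 :> A by apply: ram_inj; rewrite !ramE ?oppr0.
  rewrite [(- y) ^+ ell]exprNn -mulrnAr.
  transitivity (((-1) ^+ ell * (-1) ^+ ell) * (a * (y ^+ ell * (h v u *+ 2)))); last by ring.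
  by rewrite -exprMn mulrNN mulr1 expr1n mul1r mulrnAr.
by apply: mu1; apply/iVP; exists ((-1) ^+ ell * ram_star a *: v).
Qed.

(** Orthogonality of characters: translation by k0 multiplies the sum by a value different from 1
    unless the character is trivial on iV. *)
Lemma iV_char_sum u :
  \sum_(k in iV) mu (h k u *+ 2) = if u \in iV then #|iV|%:R else 0.
Proof.
case: ifP => [iu|/negP niu].
  rewrite -sum1_card natr_sum; apply: eq_bigr => k ik.
  by rewrite iVh // mul0rn /Defs.mu /ram_d ram_im0 mul0rn lam_char.1.
have [/forall_inP mu1|] := boolP [forall k in iV, mu (h k u *+ 2) == 1].
  by case: niu; apply: iV_char_separates => k /mu1/eqP.
rewrite negb_forall_in => /exists_inP[k0 ik0 mu_k0].
set s := \sum_(k in iV) _.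
have : s = mu (h k0 u *+ 2) * s.
  rewrite {1}/s (reindex_inj (addIr k0)) mulr_sumr /=.
  apply: eq_big => [k|k _]; first by rewrite iV_addr.
  by rewrite hDl mulrnDl hmu mulrC.
move/eqP; rewrite eq_sym -subr_eq0 -[X in _ - X]mul1r -mulrBl mulf_eq0.
by rewrite subr_eq0 (negPf mu_k0) => /eqP.
Qed.

Lemma transversal_inj i j : t_ i - t_ j \in iV -> i = j.
Proof.
have [t _ tP] := Defs.transversalP T_trans (t_ i).
rewrite tP ?enum_valP // => /eqP jt.
have := tP _ (enum_valP i); rewrite subrr iV0 => /esym/eqP it.
by apply: enum_val_inj; rewrite it jt.
Qed.

(** For k in iV each [heis_op (u + k)] sends e_(t_r) to a multiple of e_(t_r + u). Weighted by
    [chi], these multiples add up to a character sum over iV that vanishes unless r = i, and t_i + u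
    = t_j. *)
Lemma delta_heis_sum i j : exists f, delta_mx i j = heis_sum f.
Proof.
pose u := t_ j - t_ i; pose c : C := #|iV|%:R * mu (h u (t_ i)).
(* The term h k u cancels the factor from reducing t_r + u + k modulo iV; the doubled term turns t_r
   into t_r - t_i. The constant [c] is the resulting coefficient at r = i. *)
pose chi k := mu (- (h k (t_ i) *+ 2 + h k u)).
exists (fun w => if w - u \in iV then c^-1 * chi (w - u) else 0).
have -> : heis_sum (fun w => if w - u \in iV then c^-1 * chi (w - u) else 0)
          = \sum_(k in iV) (c^-1 * chi k) *: heis_op (u + k).
  rewrite /heis_sum (reindex_inj (addrI u)) [RHS]big_mkcond; apply: eq_bigr => k _ /=.
  by rewrite addrAC subrr add0r; case: ifP => // _; rewrite scale0r.
apply/row_matrixP=> r; rewrite rowE [RHS]rowE -weil_vec_enum mulmx_sumr.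
have -> : \sum_(k in iV) weil_vec (t_ r) *m ((c^-1 * chi k) *: heis_op (u + k))
   = (c^-1 * mu (h u (t_ r)) * \sum_(k in iV) mu (h k (t_ r - t_ i) *+ 2))
       *: weil_vec (t_ r + u).
  rewrite mulr_sumr scaler_suml; apply: eq_bigr => k ik.
  rewrite -scalemxAr weil_vec_op addrA (weil_vecD_iV (_ + u) ik) !scalerA.
  congr (_ *: _); rewrite -!mulrA; congr (_ * _); rewrite -!hmu; congr (mu _).
  by rewrite hDl hDr (hermBr h_herm); ring.
rewrite iV_char_sum weil_vec_enum mul_delta_mx_cond.
have [->|ri] := eqVneq r i.
  rewrite subrr iV0 mulr1n /c mulrAC -mulrA mulVf ?scale1r; last first.
    rewrite mulf_neq0 ?mu_neq0 ?C_char0 //.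
    by apply/card_gt0P; exists 0; exact: iV0.
  by rewrite addrC subrK weil_vec_enum.
by case: ifP => [/transversal_inj/eqP|]; rewrite ?(negPf ri) // mulr0 scale0r.
Qed.

Lemma heis_sum_surj (B : 'M[C]_#|T|) : exists f, B = heis_sum f.
Proof.
have /fin_all_exists[f fP] (ij : 'I_#|T| * 'I_#|T|) := delta_heis_sum ij.1 ij.2.
exists (fun w => \sum_ij B ij.1 ij.2 * f ij w).
rewrite {1}[B]matrix_sum_delta pair_bigA /=.
under eq_bigr do rewrite fP scaler_sumr.
rewrite exchange_big; apply: eq_bigr => w _ /=.
by rewrite scaler_suml; apply: eq_bigr => ij _; rewrite scalerA.
Qed.

(** Averaging over U fixes B, and since conjugation by U permutes the operators it replaces any
    coefficient function of B by its average over U. *)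
Lemma centgmx_heis_sum (B : 'M[C]_#|T|) : centgmx X B ->
  exists2 f, B = heis_sum f & forall g w, g \in U -> f (g w) = f w.
Proof.
move=> /centgmxP centB; have [f BE] := heis_sum_surj B.
pose nU : C := #|U|%:R.
have nU0 : nU != 0 by rewrite C_char0 ?cardG_gt0.
exists (fun w => nU^-1 * \sum_(g in U) f (g^-1%g w)) => [|g w Ug]; last first.
  congr (_ * _); rewrite (reindex_inj (mulIg g)) /=.
  apply: eq_big => [k|k _]; first exact: groupMr Ug.
  by rewrite invMg permM permK.
have -> : B = nU^-1 *: \sum_(g in U) X g^-1%g *m B *m X g.
  rewrite (eq_bigr (fun=> B)) => [|g Ug].
    by rewrite sumr_const -scaler_nat scalerA mulVf ?scale1r.
  by rewrite -mulmxA centB // mulmxA -repr_mxM ?groupV // mulVg repr_mx1 mul1mx.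
rewrite scaler_sumr /heis_sum.
transitivity (\sum_(g in U) \sum_w (nU^-1 * f (g^-1%g w)) *: heis_op w); last first.
  by rewrite exchange_big; apply: eq_bigr => w _; rewrite mulr_sumr scaler_suml.
apply: eq_bigr => g Ug.
rewrite BE mulmx_sumr mulmx_suml scaler_sumr.
rewrite [RHS](reindex_inj (@perm_inj _ g)) /=.
apply: eq_bigr => w _.
by rewrite permK -scalemxAr -scalemxAl heis_opJ // scalerA.
Qed.

End Spanning.
End HeisenbergOperators.

(** * Commutativity of End_U(X) *)

Theorem theorem9p2
    (R : finComNzRingType) (p : nat) (M : {set R}) (ell : nat) (x : R)
    (R_char : p \in [pchar R]) (p_odd : odd p)
    (R_local : local_ring_with_maximal_ideal M)
    (R_principal : principal_ideal_ring R)
    (ell_gt0 : (0 < ell)%N) (M_nilp : nilpotency_degree M ell)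
    (x_gen : M = principal_ideal x)
    (V : finLmodType (ramified_ext x)) (m : nat)
    (m_gt0 : (0 < m)%N) (V_free : free_of_rank V m)
    (h : V -> V -> ramified_ext x) (h_herm : nondegenerate_hermitian_form h)
    (RR : realType) (lam : R -> RR[i])
    (lam_char : additive_character lam) (lam_prim : primitive_character lam)
    (T : {set V}) (T_trans : transversal_iV ell T) :
  multiplicity_free (weil_module x_gen M_nilp h_herm lam_char T_trans).
Proof.
have C_char0 n : (0 < n)%N -> n%:R != 0 :> RR[i].
  by rewrite lt0n Num.Theory.pnatr_eq0.
apply: multiplicity_free_of_commutative_centralizer => [|B B' centB centB'].
  by rewrite C_char0 ?cardG_gt0.
have xX := weil_xX x_gen M_nilp.
have unit_or_x (r : R) : (exists s, r * s = 1) \/ exists s, r = s * x.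
  have [|] := local_unit_or_in_maximal r R_local R_principal; first by left.
  by rewrite x_gen => /imsetP[s _ ->]; right; exists s.
(* A product of [ell] - 1 elements of M is a multiple of x^(ell - 1), so its vanishing would
   contradict the minimality of [ell]. *)
have xX1 : x ^+ ell.-1 != 0.
  have [_ /(_ ell.-1)] := M_nilp; rewrite prednK // leqnn => /(_ isT) nz.
  apply/eqP => xX0; apply: nz => f fM.
  have /fin_all_exists[c cP] i : exists c, f i = c * x.
    by have := fM i; rewrite x_gen => /imsetP[c _ ->]; exists c.
  rewrite (eq_bigr _ (fun i _ => cP i)) big_split /= prodr_const card_ord.
  by rewrite xX0 mulr0.
have ann_y := ram_ann_y ell_gt0 unit_or_x xX xX1.
(* Since 2 [ell] - [ell] = [ell], the vectors killed by y^ell are those in y^ell V. *)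
have ann_iV u : ram_y x ^+ ell *: u = 0 -> u \in iV ell V.
  have le_ell : (ell <= 2 * ell)%N by rewrite leq_pmull.
  move=> /(ann_y_free V_free ann_y le_ell)[w ->]; apply/iVP; exists w.
  by rewrite mulSn mul1n addnK.
have [f -> fU] := centgmx_heis_sum R_char p_odd lam_prim C_char0 ann_iV centB.
have [f' -> f'U] := centgmx_heis_sum R_char p_odd lam_prim C_char0 ann_iV centB'.
apply: (heis_sum_comm x_gen M_nilp h_herm lam_char T_trans fU f'U) => w.
apply: (exists_orbit_preserving_anti_isometry h_herm V_free ell_gt0) => //.
- exact: ram_half R_char p_odd.
- exact: ram_unit_or_y unit_or_x xX.
- exact: ram_y_nilp xX.
- exact: ram_star_norm1 unit_or_x xX.
Qed.
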